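(* Let $d\ge 1$ be an integer and let $A,B\in\mathbb{M}_d^+$. Then, for all symmetric norms $\|\cdot\|$ on $\mathbb{M}_d$, $$ \|A\vee B\|\le \|A+B\|, $$ equivalently, $$ A\vee B\prec_w A+B. $$
   Context: $\mathbb{M}_d$ is the space of complex $d\times d$ matrices and $\mathbb{M}_d^+$ its cone of positive semidefinite matrices. A symmetric norm on $\mathbb{M}_d$ is a unitarily invariant norm: $\|UXV\|=\|X\|$ for all $X\in\mathbb{M}_d$ and all unitary $U,V\in\mathbb{M}_d$. For a Hermitian matrix $X\in\mathbb{M}_d$, $\lambda_1^{\downarrow}(X)\ge\cdots\ge\lambda_d^{\downarrow}(X)$ are its eigenvalues (with multiplicity) in nonincreasing order. For Hermitian $X,Y\in\mathbb{M}_d$, the submajorization $X\prec_w Y$ means $\sum_{j=1}^k\lambda_j^{\downarrow}(X)\le\sum_{j=1}^k\lambda_j^{\downarrow}(Y)$ for all $k=1,\ldots,d$. Spectral order and supremum: for $A\in\mathbb{M}_d^+$ and $x>0$, $\mathbf{1}_{(x,\infty)}(A)$ is the spectral projection of $A$ for the interval $(x,\infty)$. The spectral order on $\mathbb{M}_d^+$ is defined by $A\preceq B$ iff $\mathbf{1}_{(x,\infty)}(A)\le\mathbf{1}_{(x,\infty)}(B)$ for all $x>0$. Any $A,B\in\mathbb{M}_d^+$ have a least upper bound $A\vee B\in\mathbb{M}_d^+$ for $\preceq$; it is the unique matrix $C\in\mathbb{M}_d^+$ with $\mathbf{1}_{(x,\infty)}(C)=\mathbf{1}_{(x,\infty)}(A)\vee\mathbf{1}_{(x,\infty)}(B)$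 for all $x>0$, where the join of two orthogonal projections is the orthogonal projection onto the sum of their ranges. *)

(* Defs.v *)
From HB Require Import structures.
From mathcomp Require Import all_boot all_order all_algebra.
From mathcomp Require Import boolp classical_sets reals.
From mathcomp Require Import complex zify.
Set Implicit Arguments.
Unset Strict Implicit.
Unset Printing Implicit Defensive.
Import Order.TTheory GRing.Theory Num.Theory.
Local Open Scope ring_scope.
Local Open Scope sesquilinear_scope.
Local Open Scope complex_scope.

(* Complex matrices are 'M[R[i]]_d with R : realType. MathComp matrices act   *)
(* on row vectors, so subspaces are row spaces. For a Hermitian matrix P the  *)
(* row space is the entrywise conjugate of the range (column space), so sums  *)
(* and inclusions of row spaces of Hermitian projections correspond exactly   *)
(* to sums and inclusions of their ranges.                                    *)

Section HermitianOrder.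
Variables (C : numClosedFieldType) (d : nat).
Implicit Types X Y A P Q : 'M[C]_d.

(* In C, 0 <= z means that z is real and nonnegative. *)
Definition psdmx X : Prop :=
  X \is hermsymmx /\ forall v : 'cV[C]_d, 0 <= (v^t* *m X *m v) 0 0.

Definition loewner_le X Y : Prop := psdmx (Y - X).

(* f(A) for a normal matrix A, via its unitary diagonalization. *)
Definition funcalc (f : C -> C) A : 'M[C]_d :=
  invmx (spectralmx A) *m diag_mx (map_mx f (spectral_diag A)) *m spectralmx A.

(* The spectral projection of A for the interval (x, +oo), x real. *)
Definition spec_proj (x : C) A : 'M[C]_d := funcalc (fun z => (x < z)%R%:R) A.

Definition proj_join P Q : 'M[C]_d := proj_ortho (P + Q)%MS.

End HermitianOrder.

Section Definitions.
Variables (R : realType) (d : nat).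
Implicit Types (X Y A B S : 'M[R[i]]_d) (x : R).

(* Real parts are only taken to land in R: the roots of the characteristic    *)
(* polynomial of a Hermitian matrix are real.                                 *)
Definition eigvals_down X : seq R :=
  sort >=%R
    [seq complex.Re z | z <- sval (closed_field_poly_normal (char_poly X))].

Definition submaj X Y : Prop :=
  forall k : nat, (1 <= k <= d)%N ->
    \sum_(j < k) (eigvals_down X)`_j <= \sum_(j < k) (eigvals_down Y)`_j.

(* The norm takes values in R; the absolute value of a complex scalar lives   *)
(* in R[i], whence the embedding in homogeneity.                              *)
Record symmetric_norm (N : 'M[R[i]]_d -> R) : Prop := SymmetricNorm {
  symmetric_norm_def : forall X, N X = 0 -> X = 0;
  symmetric_normZ : forall (a : R[i]) X, (N (a *: X))%:C = `|a| * (N X)%:C;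
  symmetric_normD : forall X Y, N (X + Y) <= N X + N Y;
  symmetric_normU : forall U V X, U \is unitarymx -> V \is unitarymx ->
    N (U *m X *m V) = N X }.

Definition spec_le A B : Prop :=
  forall x, 0 < x -> loewner_le (spec_proj x%:C A) (spec_proj x%:C B).

Definition is_spec_sup A B S : Prop :=
  [/\ psdmx S, spec_le A S, spec_le B S
    & forall T, psdmx T -> spec_le A T -> spec_le B T -> spec_le S T].

(* The default value 0 is irrelevant: spec_supP and spec_sup_unique below     *)
(* show that A, B >= 0 have exactly one least upper bound.                    *)
Definition spec_sup A B : 'M[R[i]]_d := xget 0 [set S | is_spec_sup A B S].

End Definitions.

Section Projections.
Variables (C : numClosedFieldType) (n : nat).
Implicit Types P Q U V : 'M[C]_n.

Lemma tcM m p q (A : 'M[C]_(m, p)) (B : 'M[C]_(p, q)) :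
  (A *m B)^t* = B^t* *m A^t*.
Proof. by rewrite trmx_mul map_mxM. Qed.

Lemma tcB m p (A B : 'M[C]_(m, p)) : (A - B)^t* = A^t* - B^t*.
Proof. by rewrite linearB /= map_mxB. Qed.

Lemma tc1 : (1%:M : 'M[C]_n)^t* = 1%:M.
Proof. by rewrite trmx1 map_mx1. Qed.

Definition isproj P := P^t* = P /\ P *m P = P.

Lemma isproj_ortho m (U : 'M[C]_(m, n)) : isproj (proj_ortho U).
Proof.
split; last exact: proj_ortho_proj.
set P := proj_ortho U.
have h : (1%:M - P) *m P^t* = 0.
  apply/orthomx1P; rewrite -(mul1mx P).
  apply: submx_trans (proj_ortho_compl_sub U 1%:M) _.
  by rewrite submx_ortho mul1mx proj_orthoE.
move: P h => P h.
have h2 : P^t* = P *m P^t*.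
  by apply/eqP; rewrite -subr_eq0 -{1}[P^t*]mul1mx -mulmxBl h.
have e : (P^t*)^t* = (P *m P^t*)^t* by rewrite -h2.
rewrite tcM !trmxCK in e.
exact: etrans h2 (esym e).
Qed.

Lemma isproj_subP P Q : isproj Q -> (P <= Q)%MS -> P *m Q = P.
Proof. by move=> [_ QQ] /submxP[D ->]; rewrite -mulmxA QQ. Qed.

Lemma isproj_subPl P Q : isproj P -> isproj Q -> (P <= Q)%MS -> Q *m P = P.
Proof.
move=> [hP _] pQ /(isproj_subP pQ) /(congr1 (fun X => X^t*)).
by rewrite tcM hP pQ.1.
Qed.

Lemma isproj_eq P Q : isproj P -> isproj Q ->
  (P <= Q)%MS -> (Q <= P)%MS -> P = Q.
Proof. by move=> pP pQ h /(isproj_subP pP) <-; rewrite isproj_subPl. Qed.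

Lemma tc_mul_ge0 m (v : 'cV[C]_m) : 0 <= (v^t* *m v) 0 0.
Proof. by rewrite mxE sumr_ge0 // => j _; rewrite !mxE mulrC mul_conjC_ge0. Qed.

Lemma tc_mul_eq0 m (v : 'cV[C]_m) : (v^t* *m v) 0 0 = 0 -> v = 0.
Proof.
rewrite mxE => h; apply/colP => j; rewrite mxE.
have /(_ j isT) : forall j, true -> (v^t*) 0 j * v j 0 = 0.
  apply: psumr_eq0P => // k _.
  by rewrite !mxE mulrC mul_conjC_ge0.
by rewrite !mxE mulrC => /eqP; rewrite mul_conjC_eq0 => /eqP.
Qed.

Lemma hermsymmxP (A : 'M[C]_n) : A \is hermsymmx <-> A^t* = A.
Proof.
split; first by move/is_hermitianmxP; rewrite expr0 scale1r => {2}->.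
by move=> h; apply/is_hermitianmxP; rewrite expr0 scale1r.
Qed.

End Projections.

Section HermitianTheory.
Variables (C : numClosedFieldType) (d : nat).
Implicit Types X Y A B P Q : 'M[C]_d.

Lemma row_diag_mul (D : 'rV[C]_d) X k :
  row k (diag_mx D *m X) = D 0 k *: row k X.
Proof. by apply/rowP => j; rewrite mul_diag_mx !mxE. Qed.

Lemma isproj_psd P : isproj P -> psdmx P.
Proof.
move=> [hP PP]; split; first exact/hermsymmxP.
move=> v; rewrite -PP -{1}hP mulmxA -tcM -mulmxA.
exact: tc_mul_ge0.
Qed.

Lemma psdmx0 : psdmx (0 : 'M[C]_d).
Proof.
split; first by apply/hermsymmxP; rewrite trmx0 map_mx0.
by move=> v; rewrite mulmx0 mul0mx mxE.
Qed.

Lemma psdmxD X Y : psdmx X -> psdmx Y -> psdmx (X + Y).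
Proof.
move=> [/hermsymmxP hX pX] [/hermsymmxP hY pY]; split.
  by apply/hermsymmxP; rewrite linearD /= map_mxD hX hY.
by move=> v; rewrite mulmxDr mulmxDl mxE addr_ge0.
Qed.

Lemma loewner_projP P Q : isproj P -> isproj Q ->
  loewner_le P Q <-> (P <= Q)%MS.
Proof.
move=> pP pQ; split=> [[_ h]|sPQ].
- suff e : P *m (1%:M - Q) = 0.
    move/eqP: e; rewrite mulmxBr mulmx1 subr_eq0 => /eqP ->.
    exact: submxMl.
  have hE : (1%:M - Q)^t* = 1%:M - Q by rewrite tcB tc1 pQ.1.
  have kill v : P *m (1%:M - Q) *m v = 0 :> 'cV[C]_d.
    apply: tc_mul_eq0; apply/eqP; rewrite eq_le tc_mul_ge0 andbT.
    have := h ((1%:M - Q) *m v).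
    rewrite tcM hE mulmxBr mulmxBl.
    rewrite -(mulmxA _ _ Q) mulmxBl mul1mx pQ.2 subrr mulmx0 mul0mx sub0r mxE.
    rewrite oppr_ge0 !tcM hE pP.1.
    by rewrite -{1}pP.2 !mulmxA.
  apply/matrixP => i j; have /colP/(_ i) := kill (delta_mx j 0).
  by rewrite -colE !mxE.
- apply: isproj_psd; split; first by rewrite tcB pP.1 pQ.1.
  rewrite mulmxBr !mulmxBl pP.2 pQ.2 isproj_subP // isproj_subPl //.
  by rewrite subrr subr0.
Qed.

Lemma psd_normal A : psdmx A -> A \is normalmx.
Proof. by case=> /hermitian_normalmx. Qed.

Lemma spectral_mul A : A \is normalmx ->
  spectralmx A *m A = diag_mx (spectral_diag A) *m spectralmx A.
Proof.
move=> /orthomx_spectralP {2}->.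
by rewrite !mulmxA mulmxV ?spectral_unit // mul1mx.
Qed.

Lemma spectral_diag_ge0 A k : psdmx A -> 0 <= spectral_diag A 0 k.
Proof.
move=> pA; have /spectral_mul e := psd_normal pA.
have := proj2 pA ((row k (spectralmx A))^t*); rewrite trmxCK.
rewrite -row_mul e row_diag_mul -scalemxAl mxE -dotmxE.
by have /row_unitarymxP -> := spectral_unitarymx A; rewrite eqxx mulr1.
Qed.

Lemma funcalc_ext (f g : C -> C) A :
  (forall k, f (spectral_diag A 0 k) = g (spectral_diag A 0 k)) ->
  funcalc f A = funcalc g A.
Proof.
move=> h; rewrite /funcalc; congr (_ *m diag_mx _ *m _).
by apply/rowP => k; rewrite !mxE.
Qed.

Lemma funcalcM (f g : C -> C) A :
  funcalc f A *m funcalc g A = funcalc (fun z => f z * g z) A.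
Proof.
rewrite /funcalc !mulmxA mulmxK ?spectral_unit // -(mulmxA _ (diag_mx _) (diag_mx _)).
rewrite mulmx_diag; congr (_ *m diag_mx _ *m _).
by apply/rowP => k; rewrite !mxE.
Qed.

(* Functional calculus does not depend on the chosen diagonalization. *)
Lemma funcalc_sum (I : finType) (mu : I -> C) (E : I -> 'M[C]_d) A f :
  A \is normalmx -> \sum_i E i = 1%:M ->
  (forall i, A *m E i = mu i *: E i) ->
  funcalc f A = \sum_i f (mu i) *: E i.
Proof.
move=> nA E1 AE.
have h i : diag_mx (map_mx f (spectral_diag A)) *m (spectralmx A *m E i)
    = f (mu i) *: (spectralmx A *m E i).
  apply/row_matrixP => k; rewrite row_diag_mul mxE linearZ /=.
  have := congr1 (row k) (congr1 (mulmx^~ (E i)) (spectral_mul nA)).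
  rewrite -!mulmxA AE -scalemxAr row_diag_mul linearZ /= => /eqP.
  rewrite -subr_eq0 -scalerBl scaler_eq0 subr_eq0.
  by case/orP=> /eqP ->; rewrite ?scaler0.
rewrite -[funcalc f A]mulmx1 -E1 mulmx_sumr; apply: eq_bigr => i _.
rewrite /funcalc -!mulmxA h -scalemxAr mulmxA.
by rewrite mulVmx ?spectral_unit // mul1mx.
Qed.

Lemma isproj_join P Q : isproj (proj_join P Q).
Proof. exact: isproj_ortho. Qed.

Lemma join_ubl P Q : isproj P -> loewner_le P (proj_join P Q).
Proof.
move=> pP; apply/(loewner_projP pP (isproj_join P Q)).
by rewrite /proj_join proj_orthoE addsmxSl.
Qed.

Lemma join_ubr P Q : isproj Q -> loewner_le Q (proj_join P Q).
Proof.
move=> pQ; apply/(loewner_projP pQ (isproj_join P Q)).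
by rewrite /proj_join proj_orthoE addsmxSr.
Qed.

Lemma join_lub P Q T : isproj P -> isproj Q -> isproj T ->
  loewner_le P T -> loewner_le Q T -> loewner_le (proj_join P Q) T.
Proof.
move=> pP pQ pT /(loewner_projP pP pT) PT /(loewner_projP pQ pT) QT.
apply/(loewner_projP (isproj_join P Q) pT).
by rewrite /proj_join proj_orthoE addsmx_sub PT QT.
Qed.

Lemma proj_join0 : proj_join (0 : 'M[C]_d) 0 = 0.
Proof.
by apply/eqP; rewrite -submx0 /proj_join proj_orthoE addsmx_sub submx0 eqxx.
Qed.

Lemma hermitian_eigenvalue_real X (z : C) :
  X \is hermsymmx -> eigenvalue X z -> z \is Num.real.
Proof.
move=> hX /eigenvalueP[v vX v0].
have nX := hermitian_normalmx hX; have uX := spectral_unit X.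
pose w := v *m invmx (spectralmx X).
have vE : v = w *m spectralmx X by rewrite mulmxKV.
have wD : w *m diag_mx (spectral_diag X) = z *: w.
  apply: (can_inj (mulmxK uX)).
  by rewrite -mulmxA -(spectral_mul nX) mulmxA -vE vX -scalemxAl -vE.
have [k wk] : exists k, w 0 k != 0.
  apply/existsP; apply: contraNT v0; rewrite negb_exists => /forallP w0.
  rewrite vE (_ : w = 0) ?mul0mx //; apply/rowP => k.
  by rewrite [RHS]mxE; apply/eqP; rewrite -[_ == _]negbK.
clearbody w; move/rowP/(_ k): wD; rewrite mul_mx_diag !mxE => e.
have <- : spectral_diag X 0 k = z by apply: (mulIf wk); rewrite mulrC.
by have /mxOverP := hermitian_spectral_diag_real hX; exact.
Qed.

End HermitianTheory.

(* The concrete carrier R[i] makes unification very slow in long matrix       *)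
(* computations, so the existence of least upper bounds is proved for an      *)
(* abstract field C with an order embedding iota of R, later x |-> x%:C.      *)
Section SpectralOrder.
Variables (R : realFieldType) (C : numClosedFieldType) (d : nat).
Variables (iota : {rmorphism R -> C}) (re : C -> R).
Variable le_iota : {mono iota : x y / x <= y}.
Variable iota_re : forall z : C, 0 <= z -> iota (re z) = z /\ 0 <= re z.
Implicit Types (X Y A B S T P Q : 'M[C]_d) (x y : R).

Let lt_iota : {mono iota : x y / x < y} := leW_mono le_iota.

Lemma psdmxZ (x : C) X : 0 <= x -> psdmx X -> psdmx (x *: X).
Proof.
move=> x0 [/hermsymmxP hX pX]; split.
  apply/hermsymmxP; rewrite linearZ /= map_mxZ hX; congr (_ *: _).
  by apply: conj_Creal; apply: ger0_real.
by move=> v; rewrite -scalemxAr -scalemxAl mxE mulr_ge0.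
Qed.

Lemma isproj_spec (x : C) A : isproj (spec_proj x A).
Proof.
split; last first.
  by rewrite funcalcM; apply: funcalc_ext => k; rewrite -natrM mulnb andbb.
rewrite /spec_proj /funcalc invmx_unitary ?spectral_unitarymx //.
rewrite !tcM trmxCK mulmxA; congr (_ *m _ *m _).
apply/matrixP => i j; rewrite !mxE rmorphMn /= conjC_nat eq_sym.
by case: eqVneq => [->|].
Qed.

Lemma spec_proj_mono (x y : C) A : x <= y -> (spec_proj y A <= spec_proj x A)%MS.
Proof.
move=> xy; suff <- : spec_proj y A *m spec_proj x A = spec_proj y A.
  exact: submxMl.
rewrite funcalcM; apply: funcalc_ext => k; rewrite -natrM mulnb.
case h: (_ < _) => //=; by rewrite (le_lt_trans _ h).
Qed.

Lemma spec_proj_ext (x y : C) A :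
  (forall k, (x < spectral_diag A 0 k) = (y < spectral_diag A 0 k)) ->
  spec_proj x A = spec_proj y A.
Proof. by move=> h; apply: funcalc_ext => k; rewrite h. Qed.

Lemma spec_proj_eq0 (x : C) A :
  (forall k, (x < spectral_diag A 0 k) = false) -> spec_proj x A = 0.
Proof.
move=> h; rewrite /spec_proj /funcalc.
rewrite (_ : map_mx _ _ = 0) ?linear0 ?mulmx0 ?mul0mx //.
by apply/rowP => k; rewrite !mxE h.
Qed.

(* A psd matrix is determined by its spectral projections. *)
Lemma spec_proj_inj A B : psdmx A -> psdmx B ->
  (forall x, 0 < x -> spec_proj (iota x) A = spec_proj (iota x) B) -> A = B.
Proof.
move=> pA pB h.
have uA := spectral_unit A; have uB := spectral_unit B.
have eA := spectral_mul (psd_normal pA); have eB := spectral_mul (psd_normal pB).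
suff e : spectralmx A *m B = spectralmx A *m A.
  by rewrite -[A](mulKmx uA) -e mulKmx.
rewrite eA; pose W := spectralmx A *m invmx (spectralmx B).
have WE : spectralmx A = W *m spectralmx B by rewrite mulmxKV.
have key x : 0 < x ->
    diag_mx (map_mx (fun z => (iota x < z)%R%:R) (spectral_diag A)) *m W =
    W *m diag_mx (map_mx (fun z => (iota x < z)%R%:R) (spectral_diag B)).
  move=> x0; have := congr1 (mulmx (spectralmx A)) (h x x0).
  rewrite /spec_proj /funcalc !mulmxA mulmxV // mul1mx => e.
  by rewrite e mulmxK.
clearbody W; rewrite WE -mulmxA eB !mulmxA; congr (_ *m _).
apply/matrixP => i j; rewrite mul_mx_diag mul_diag_mx !mxE.
have [->|Wij] := eqVneq (W i j) 0; first by rewrite mul0r mulr0.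
rewrite mulrC; congr (_ * _).
have cmp x : 0 < x ->
    (iota x < spectral_diag A 0 i) = (iota x < spectral_diag B 0 j).
  move=> /key /matrixP /(_ i j); rewrite mul_mx_diag mul_diag_mx !mxE.
  rewrite [RHS]mulrC => /(mulIf Wij) /eqP; rewrite eqr_nat.
  by case: (_ < _); case: (_ < _).
have := spectral_diag_ge0 i pA; have := spectral_diag_ge0 j pB.
move: (spectral_diag A 0 i) (spectral_diag B 0 j) cmp => a' b' cmp.
move=> /iota_re[hb b0] /iota_re[ha a0]; rewrite -ha -hb in cmp *.
move: (re a') (re b') a0 b0 cmp {ha hb} => a b a0 b0 cmp.
have {}cmp x : 0 < x -> (x < a) = (x < b) by move=> /cmp; rewrite !lt_iota.
have midpt (u v : R) : 0 <= u -> u < v ->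
    [/\ 0 < (u + v) / 2, u < (u + v) / 2 & (u + v) / 2 < v].
  move=> u0 uv; have [m1 m2] := midf_lt uv; split=> //; exact: le_lt_trans u0 m1.
have [ab|ba|->//] := ltgtP a b.
- have [m0 am mb] := midpt _ _ a0 ab.
  by have := cmp _ m0; rewrite mb ltNge ltW.
- have [m0 bm ma] := midpt _ _ b0 ba.
  by have := cmp _ m0; rewrite ma ltNge ltW.
Qed.

Lemma spec_sup_exists A B : psdmx A -> psdmx B ->
  exists2 S, psdmx S & forall x, 0 < x ->
    spec_proj (iota x) S =
    proj_join (spec_proj (iota x) A) (spec_proj (iota x) B).
Proof.
move=> pA pB.
pose J x := proj_join (spec_proj (iota x) A) (spec_proj (iota x) B).
have pJ x : isproj (J x) by exact: isproj_join.
have J_anti x y : x <= y -> (J y <= J x)%MS.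
  move=> xy; rewrite /J /proj_join !proj_orthoE.
  by apply: addsmxS; apply: spec_proj_mono; rewrite le_iota.
pose evs := [seq re (spectral_diag A 0 k) | k : 'I_d] ++
            [seq re (spectral_diag B 0 k) | k : 'I_d].
pose s := 0 :: sort <=%R [seq u <- evs | 0 < u].
pose t i := s`_i.
have s_sorted : sorted <=%R s.
  rewrite /= path_min_sorted; first by apply: sort_sorted; exact: le_total.
  by apply/allP => u; rewrite mem_sort mem_filter => /andP[/ltW].
have t_mono i j : (i <= j < size s)%N -> t i <= t j.
  move=> /andP[ij js]; apply: (sorted_leq_nth le_trans le_refl) => //.
  by rewrite inE (leq_ltn_trans ij).
have s_ge0 i : 0 <= t i.
  have [lt|ge] := ltnP i (size s); last by rewrite /t nth_default.
  by apply: (t_mono 0%N); rewrite lt.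
have diagE X k : psdmx X ->
    spectral_diag X 0 k = iota (re (spectral_diag X 0 k)).
  by move=> /(spectral_diag_ge0 k) /iota_re[].
have inA k : re (spectral_diag A 0 k) \in evs.
  rewrite mem_cat; apply/orP; left; apply/mapP; exists k => //.
  exact: mem_enum.
have inB k : re (spectral_diag B 0 k) \in evs.
  rewrite mem_cat; apply/orP; right; apply/mapP; exists k => //.
  exact: mem_enum.
have J_ext x y : (forall u, u \in evs -> (x < u) = (y < u)) -> J x = J y.
  move=> h; rewrite /J.
  have eA : spec_proj (iota x) A = spec_proj (iota y) A.
    apply: spec_proj_ext => k.
    by rewrite (diagE A k pA) !lt_iota (h _ (inA k)).
  have eB : spec_proj (iota x) B = spec_proj (iota y) B.
    apply: spec_proj_ext => k.
    by rewrite (diagE B k pB) !lt_iota (h _ (inB k)).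
  by rewrite eA eB.
have J_eq0 x : (forall u, u \in evs -> u <= x) -> J x = 0.
  move=> h; rewrite /J.
  have -> : spec_proj (iota x) A = 0.
    apply: spec_proj_eq0 => k.
    by rewrite (diagE A k pA) lt_iota ltNge (h _ (inA k)).
  have -> : spec_proj (iota x) B = 0.
    apply: spec_proj_eq0 => k.
    by rewrite (diagE B k pB) lt_iota ltNge (h _ (inB k)).
  exact: proj_join0.
clear inA inB diagE.
pose K i := if i is j.+1 then J (t j) else 1%:M.
have pK i : isproj (K i).
  by case: i => [|i] //=; split; rewrite ?tc1 ?mulmx1.
have K_anti i j : (i <= j <= size s)%N -> (K j <= K i)%MS.
  case: i j => [|i] [|j] //= h; rewrite ?submx1 //.
  by apply: J_anti; apply: t_mono.
have K_last : K (size s) = 0.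
  rewrite /K /=; apply: J_eq0 => u uin.
  have [u0|u0] := ltP 0 u; last exact: le_trans u0 (s_ge0 _).
  have us : u \in s by rewrite inE mem_sort mem_filter u0 uin orbT.
  rewrite -(nth_index 0 us); apply: t_mono.
  have hs : (index u s < size s)%N by rewrite index_mem.
  by apply/andP; split; [exact: hs | exact: ltnSn].
have K0 : K 0%N = 1%:M by [].
have KS i : (0 < i)%N -> K i = J (t i.-1) by case: i.
clearbody K.
pose E (i : 'I_(size s)) : 'M[C]_d := K i - K i.+1.
have pE i : isproj (E i).
  rewrite /E; have sK : (K i.+1 <= K i)%MS by apply: K_anti; rewrite leqnSn ltn_ord.
  split; first by rewrite tcB (pK _).1 (pK _).1.
  rewrite mulmxBr !mulmxBl (pK _).2 (pK _).2 isproj_subP // isproj_subPl //.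
  by rewrite subrr subr0.
have KM i j : (i <= j <= size s)%N -> K i *m K j = K j /\ K j *m K i = K j.
  by move=> h; rewrite isproj_subPl ?isproj_subP //; exact: K_anti.
have E_ortho (i j : 'I_(size s)) : (i < j)%N -> E i *m E j = 0 /\ E j *m E i = 0.
  move=> ij; have js := ltn_ord j.
  rewrite /E !mulmxBr !mulmxBl.
  have [-> ->] : K i *m K j = K j /\ K j *m K i = K j.
    by apply: KM; lia.
  have [-> ->] : K i.+1 *m K j = K j /\ K j *m K i.+1 = K j.
    by apply: KM; lia.
  have [-> ->] : K i *m K j.+1 = K j.+1 /\ K j.+1 *m K i = K j.+1.
    by apply: KM; lia.
  have [-> ->] : K i.+1 *m K j.+1 = K j.+1 /\ K j.+1 *m K i.+1 = K j.+1.
    by apply: KM; lia.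
  by rewrite !subrr.
have tele a b : (a <= b)%N -> \sum_(a <= i < b) (K i - K i.+1) = K a - K b.
  move=> ab; under eq_bigr => i _ do rewrite -opprB.
  by rewrite sumrN telescope_sumr // opprB.
have E_sum : \sum_i E i = 1%:M.
  rewrite /E -(big_mkord xpredT (fun i => K i - K i.+1)) tele // K_last K0.
  by rewrite subr0.
pose S : 'M[C]_d := \sum_(i < size s) iota (t i) *: E i.
have SE (i : 'I_(size s)) : S *m E i = iota (t i) *: E i.
  rewrite /S mulmx_suml (bigD1 i) //= -scalemxAl (pE i).2 big1 ?addr0 // => j.
  move=> ji; rewrite -scalemxAl.
  have [lt|gt|/val_inj e] := ltngtP j i; last by rewrite e eqxx in ji.
  - by rewrite (E_ortho _ _ lt).1 scaler0.
  - by rewrite (E_ortho _ _ gt).2 scaler0.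
have pS : psdmx S.
  rewrite /S; apply: big_ind => [||i _]; [exact: psdmx0|exact: psdmxD|].
  by apply: psdmxZ; [rewrite -(rmorph0 iota) le_iota | exact: isproj_psd].
exists S => // x x0.
rewrite /spec_proj (funcalc_sum _ (psd_normal pS) E_sum SE).
pose F i := ((iota x < iota (t i))%R)%:R *: (K i - K i.+1).
rewrite -(big_mkord xpredT F) /=; pose c := find (fun u => x < u) s.
have cs : (c <= size s)%N by exact: find_size.
have c0 : (0 < c)%N by rewrite /c /= ltNge ltW.
have t_le i : (i < c)%N -> t i <= x.
  by move=> /(before_find 0) /= h; rewrite leNgt -/(t i) in h *; rewrite h.
have t_gt i : (c <= i < size s)%N -> x < t i.
  move=> /andP[ci is_]; apply: lt_le_trans (t_mono c i _); last by rewrite ci.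
  by apply: (nth_find 0); rewrite has_find (leq_ltn_trans ci).
rewrite (big_cat_nat _ cs) //= [X in X + _]big_nat_cond big1 ?add0r; last first.
  by move=> i /andP[/andP[_ ic] _]; rewrite /F lt_iota ltNge t_le //= scale0r.
under eq_big_nat => i ci do rewrite /F lt_iota t_gt // scale1r.
rewrite tele // K_last subr0 -/(J x).
rewrite (KS _ c0).
apply: J_ext => u uin.
have [xu|ux] := ltP x u; first by rewrite (le_lt_trans _ xu) // t_le // prednK.
apply/negbTE; rewrite -leNgt.
have [u0|u0] := ltP 0 u; last exact: le_trans u0 (s_ge0 _).
have us : u \in s by rewrite inE mem_sort mem_filter u0 uin orbT.
rewrite -(nth_index 0 us); apply: t_mono.
have ic : (index u s < c)%N.
  rewrite ltnNge; apply/negP => ci; have := t_gt (index u s).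
  by rewrite ci index_mem us /t nth_index // => /(_ isT); rewrite ltNge ux.
by rewrite -ltnS prednK // ic (leq_trans _ cs) // prednK.
Qed.

End SpectralOrder.

Section Existence.
Variables (R : realType) (d : nat).
Local Notation C := R[i].
Implicit Types (X Y A B S T P Q : 'M[R[i]]_d) (x y : R).

Lemma spec_le_sub x A B : spec_le A B -> 0 < x ->
  (spec_proj x%:C A <= spec_proj x%:C B)%MS.
Proof. by move=> h /h; rewrite loewner_projP //; exact: isproj_spec. Qed.

Let le_iota : {mono real_complex R : x y / x <= y}.
Proof. exact: lecR. Qed.

Let iota_re (z : C) :
  0 <= z -> real_complex R (complex.Re z) = z /\ 0 <= complex.Re z.
Proof. by case: z => a b; rewrite lecE /= => /andP[/eqP -> ->]. Qed.

Lemma spec_le_anti A B : psdmx A -> psdmx B ->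
  spec_le A B -> spec_le B A -> A = B.
Proof.
move=> pA pB AB BA; apply: (spec_proj_inj le_iota iota_re pA pB) => x x0.
apply: isproj_eq; [exact: isproj_spec | exact: isproj_spec | |].
  exact: spec_le_sub AB x0.
exact: spec_le_sub BA x0.
Qed.

Lemma eigvals_down_sorted X : sorted >=%R (eigvals_down X).
Proof. by apply: sort_sorted => x y; exact: le_total. Qed.

Lemma char_poly_eigvals_down X : X \is hermsymmx ->
  char_poly X = \prod_(a <- eigvals_down X) ('X - (a%:C)%:P).
Proof.
move=> hX; rewrite /eigvals_down (perm_big _ (permEl (perm_sort _ _))) big_map.
case: (closed_field_poly_normal _) => r /= e.
have e1 : char_poly X = \prod_(z <- r) ('X - z%:P).
  by rewrite e (monicP (char_poly_monic X)) scale1r.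
rewrite {1}e1 !big_seq; apply: eq_bigr => z zr; congr (_ - _%:P).
have : z \is Num.real.
  apply: hermitian_eigenvalue_real hX _.
  by rewrite eigenvalue_root_char e1 root_prod_XsubC.
by move/CrealP; case: (z) => a b /= [] /eqP;
   rewrite eq_sym -addr_eq0 -mulr2n mulrn_eq0 /= => /eqP ->.
Qed.

Lemma size_eigvals_down X : X \is hermsymmx -> size (eigvals_down X) = d.
Proof.
move=> /char_poly_eigvals_down /(congr1 (fun p : {poly C} => size p)).
by rewrite size_char_poly size_prod_XsubC => -[].
Qed.

Lemma is_spec_supP A B S : psdmx A -> psdmx B ->
  (forall x, 0 < x -> spec_proj x%:C S =
     proj_join (spec_proj x%:C A) (spec_proj x%:C B)) ->
  psdmx S -> is_spec_sup A B S.
Proof.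
move=> pA pB h pS; split=> [|x x0|x x0|T pT AT BT x x0]; first exact: pS.
- by rewrite (h _ x0); apply: join_ubl; exact: isproj_spec.
- by rewrite (h _ x0); apply: join_ubr; exact: isproj_spec.
- rewrite (h _ x0); apply: join_lub; [exact: isproj_spec.. | |].
    exact: AT.
  exact: BT.
Qed.

Lemma spec_supP A B : psdmx A -> psdmx B -> is_spec_sup A B (spec_sup A B).
Proof.
move=> pA pB; apply: (@xgetPex _ 0 [set S | is_spec_sup A B S]).
by have [S pS h] := spec_sup_exists le_iota iota_re pA pB; exists S; exact: is_spec_supP.
Qed.

Lemma spec_sup_unique A B S : is_spec_sup A B S -> S = spec_sup A B.
Proof.
move=> h; have [pS AS BS lS] := h.
have [pT AT BT lT] := xgetI 0 h.
apply: (spec_le_anti pS pT); first exact: (lS _ pT AT BT).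
exact: (lT _ pS AS BS).
Qed.

Lemma spec_proj_sup A B x : psdmx A -> psdmx B -> 0 < x ->
  spec_proj x%:C (spec_sup A B) =
    proj_join (spec_proj x%:C A) (spec_proj x%:C B).
Proof.
move=> pA pB; have [S pS h] := spec_sup_exists le_iota iota_re pA pB.
by rewrite -(spec_sup_unique (is_spec_supP pA pB h pS)); exact: h.
Qed.

End Existence.

(* Main.v *)
(* For every x > 0 the projection 1_(x,oo)(A v B) is the join of 1_(x,oo)(A)
   and 1_(x,oo)(B), so its rank is at most the sum of their ranks: A v B has at
   most as many eigenvalues above x as A and B together.  Hence the sum of the
   top k eigenvalues of A v B is at most the sum of some k of the eigenvalues
   of A and B (counted together).  If E is the projection onto the span of the
   corresponding eigenvectors, that sum is at most tr E(A + B), which by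
   Ky Fan's principle is at most the sum of the top k eigenvalues of A + B.
   The norm inequality follows by Fan dominance. *)
Require Import Defs.
From mathcomp Require Import all_boot all_order all_algebra.
From mathcomp Require Import reals complex.
From mathcomp Require Import perm zify ring lra.
Import Order.TTheory GRing.Theory Num.Theory.
Local Open Scope ring_scope.
Local Open Scope complex_scope.

Set Implicit Arguments.
Unset Strict Implicit.
Unset Printing Implicit Defensive.
Local Open Scope sesquilinear_scope.

(** * Weak majorization and symmetric convex functions *)

(* Induction on the number of coordinates where x and y differ: if k is the
   first index with y_k < x_k and j < k has x_j < y_j, moving mass from y_j to
   y_k averages y with its transposition and makes one more coordinate agree. *)
Lemma submajorized_gauge_le (F : realFieldType) d (g : 'rV[F]_d -> F) :
  (forall t y z, 0 <= t <= 1 ->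
     g ((1 - t) *: y + t *: z) <= (1 - t) * g y + t * g z) ->
  (forall i j y, g (xcol i j y) = g y) ->
  (forall x y : 'rV[F]_d, (forall i, 0 <= x 0 i <= y 0 i) -> g x <= g y) ->
  forall x y : 'rV[F]_d,
  (forall i j : 'I_d, (i <= j)%N -> x 0 j <= x 0 i) ->
  (forall i, 0 <= x 0 i) -> (forall i, 0 <= y 0 i) ->
  (forall l, (l <= d)%N ->
     \sum_(i < d | (i < l)%N) x 0 i <= \sum_(i < d | (i < l)%N) y 0 i) ->
  g x <= g y.
Proof.
move=> g_conv g_xcol g_mono x y x_anti x0.
have [n] := ubnP #|[set i | x 0 i != y 0 i]|; elim: n => // n IHn in y *.
move=> dis y0 xy.
case: (pickP (fun i => y 0 i < x 0 i)) => [k0 yk0|no_k]; last first.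
  by apply: g_mono => i; rewrite x0 leNgt no_k.
case: (@arg_minnP _ k0 (fun i => y 0 i < x 0 i) (@nat_of_ord d) yk0).
move=> k yk k_min {k0 yk0}.
have le_k (i : 'I_d) : (i < k)%N -> x 0 i <= y 0 i.
  by move=> ik; rewrite leNgt; apply/negP => /k_min; rewrite leqNgt ik.
(* If no such [j] existed, [y] would be at most [x] before [k] and strictly below it at [k],
   contradicting the partial sum hypothesis at [k.+1]. *)
have [j jk xj] : exists2 j : 'I_d, (j < k)%N & x 0 j < y 0 j.
  case: (pickP (fun j : 'I_d => (j < k)%N && (x 0 j < y 0 j))) => [j /andP[]|no_j].
    by exists j.
  suff : \sum_(i < d | (i < k.+1)%N) y 0 i < \sum_(i < d | (i < k.+1)%N) x 0 i.
    by rewrite ltNge xy.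
  rewrite (bigD1 k) //= [ltRHS](bigD1 k) //=; apply: ltr_leD => //.
  apply: ler_sum => i /andP[ik nik].
  have ik' : (i < k)%N by move: ik nik; rewrite -val_eqE /=; lia.
  by rewrite leNgt; have := no_j i; rewrite ik' /= => ->.
have xkj : x 0 k <= x 0 j by apply: x_anti; apply: ltnW.
have x0k := x0 k; have y0k := y0 k.
have njk : (k == j) = false by rewrite -val_eqE /=; lia.
(* The largest mass movable from [j] to [k] without overshooting [x]; one of the two coordinates
   then agrees exactly. *)
pose e := Num.min (y 0 j - x 0 j) (x 0 k - y 0 k).
have e1 : e <= y 0 j - x 0 j by rewrite ge_min lexx.
have e2 : e <= x 0 k - y 0 k by rewrite ge_min lexx orbT.
have e0 : 0 <= e by rewrite le_min; apply/andP; split; lra.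
have eE : e = y 0 j - x 0 j \/ e = x 0 k - y 0 k.
  by rewrite /e; case: (leP (y 0 j - x 0 j)) => _; [left|right].
clearbody e.
pose y' := \row_i (y 0 i + (- e * (i == j)%:R + e * (i == k)%:R)).
have y'j : y' 0 j = y 0 j - e by rewrite mxE eqxx eq_sym njk /=; ring.
have y'k : y' 0 k = y 0 k + e by rewrite mxE eqxx njk /=; ring.
have y'E i : i != j -> i != k -> y' 0 i = y 0 i.
  by rewrite mxE => /negbTE-> /negbTE-> /=; ring.
have y'0 i : y' 0 i = y 0 i + (- e * (i == j)%:R + e * (i == k)%:R) by rewrite mxE.
clearbody y'.
have sum_delta (l : nat) (m : 'I_d) :
    \sum_(i < d | (i < l)%N) (i == m)%:R = (m < l)%N%:R :> F.
  rewrite big_mkcond (bigD1 m) //= eqxx big1 ?addr0 => [|i /negbTE->].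
    by case: ifP.
  by case: ifP.
apply: (@le_trans _ _ (g y')); last first.
  (* Averaging with the transposition moves mass [t * (y 0 j - y 0 k)]. Here [t <= 1] because
     [e <= y 0 j - x 0 j] and [y 0 k < x 0 k <= x 0 j]. *)
  pose t := e / (y 0 j - y 0 k).
  have D0 : 0 < y 0 j - y 0 k by lra.
  have t01 : 0 <= t <= 1.
    by rewrite divr_ge0 ?(ltW D0) //= ler_pdivrMr // mul1r; lra.
  have -> : y' = (1 - t) *: y + t *: xcol j k y.
    have tE : t * (y 0 j - y 0 k) = e by rewrite divfK // gt_eqF.
    apply/rowP => i; rewrite !mxE.
    have [->|nij] := eqVneq i j; first by rewrite tpermL y'j -tE; ring.
    have [->|nik] := eqVneq i k; first by rewrite ?tpermR y'k -tE; ring.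
    by rewrite y'E // tpermD 1?eq_sym //; ring.
  apply: le_trans (g_conv _ _ _ t01) _; rewrite g_xcol.
  by rewrite -mulrDl subrK mul1r.
apply: IHn => [|i|l ld].
- rewrite ltnS in dis; apply: leq_trans (proper_card _) dis.
  apply/properP; split.
    apply/subsetP => i; rewrite !inE.
    have [->|nij] := eqVneq i j; first by rewrite (lt_eqF xj) ?implybT.
    have [->|nik] := eqVneq i k; first by rewrite (gt_eqF yk) ?implybT.
    by rewrite y'E.
  case: eE => eE; [exists j|exists k]; rewrite !inE.
  + by rewrite (lt_eqF xj) ?implybT.
  + by rewrite negbK y'j eE; apply/eqP; ring.
  + by rewrite (gt_eqF yk) ?implybT.
  + by rewrite negbK y'k eE; apply/eqP; ring.
- have [->|nij] := eqVneq i j; first by rewrite y'j; lra.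
  have [->|nik] := eqVneq i k; first by rewrite y'k; lra.
  by rewrite y'E.
under [leRHS]eq_bigr => i _ do rewrite y'0.
rewrite big_split big_split /= -!mulr_sumr !sum_delta.
(* The partial sum changes only when [j < l <= k], where it drops by [e <= y 0 j - x 0 j]; the other
   indices below [l] precede [k], so [x <= y] there term by term. *)
have [kl|lk] := ltnP k l.
  by rewrite (ltn_trans jk kl) !mulr1 addNr addr0 xy.
have [jl|lj] := ltnP j l; last by rewrite !mulr0 !addr0 xy.
rewrite mulr1 mulr0 addr0 (bigD1 j) //= [in leRHS](bigD1 j) //=.
have : \sum_(i < d | (i < l)%N && (i != j)) x 0 i <=
       \sum_(i < d | (i < l)%N && (i != j)) y 0 i.
  by apply: ler_sum => i /andP[il _]; apply: le_k; apply: leq_trans il lk.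
by move: (\sum_(i < d | _) x 0 i) (\sum_(i < d | _) y 0 i) => s1 s2; lra.
Qed.

(** * Similarity, traces of idempotents and weighted sums *)

Lemma char_poly_similar (F : fieldType) n (P M N : 'M[F]_n) :
  P \in unitmx -> P *m M = N *m P -> char_poly M = char_poly N.
Proof.
rewrite unitmxE unitfE => uP e; rewrite /char_poly.
have uP' : \det (map_mx polyC P) != 0 by rewrite det_map_mx polyC_eq0.
apply: (mulIf uP'); rewrite mulrC -!det_mulmx; congr (\det _).
by rewrite /char_poly_mx mulmxBr mulmxBl -!map_mxM e scalar_mxC.
Qed.

(** A full-rank factorization [P = c *m r] turns idempotence into [r *m c = 1%:M], and the trace is
    cyclic. *)
Lemma mxtrace_idem (F : fieldType) n (P : 'M[F]_n) :
  P *m P = P -> \tr P = (\rank P)%:R.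
Proof.
move=> PP; move: (mulmx_base P) (row_base_free P) (col_base_full P).
move: (row_base P) (col_base P) => r c crP r_free c_full.
have e : r *m c = 1%:M.
  apply: (row_free_inj r_free); apply: (row_full_inj c_full).
  by rewrite mul1mx !mulmxA crP -mulmxA crP.
by rewrite -{1}crP mxtrace_mulC e mxtrace1.
Qed.

(* Subtracting l_(k-1) from every weight l_j makes the terms with j < k
   nonnegative and the others nonpositive. *)
Lemma weighted_sum_le (F : numDomainType) d (l p : 'I_d -> F) (k : nat) :
  (k <= d)%N -> (forall i j : 'I_d, (i <= j)%N -> l j <= l i) ->
  (forall i, 0 <= l i) -> (forall i, 0 <= p i <= 1) ->
  \sum_i p i <= k%:R -> \sum_i l i * p i <= \sum_(i < d | (i < k)%N) l i.
Proof.
case: k => [|k] kd l_anti l0 p01 sp.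
  rewrite [leRHS]big1 // big1 // => i _.
  have pi0 : p i = 0.
    have s0 : \sum_i p i = 0.
      by apply/le_anti; rewrite sp sumr_ge0 // => j _; case/andP: (p01 j).
    by apply: (psumr_eq0P _ s0) => // j _; case/andP: (p01 j).
  by rewrite pi0 mulr0.
pose t := l (Ordinal kd).
have -> : \sum_i l i * p i = \sum_i (l i - t) * p i + t * \sum_i p i.
  by rewrite mulr_sumr -big_split /=; apply: eq_bigr => i _; rewrite mulrBl subrK.
have -> : \sum_(i < d | (i < k.+1)%N) l i =
    \sum_(i < d | (i < k.+1)%N) (l i - t) + t * k.+1%:R.
  rewrite sumrB -(big_ord_widen d (fun=> t) kd) sumr_const card_ord.
  by rewrite mulr_natr subrK.
apply: lerD; last exact: (ler_wpM2l (l0 _)).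
rewrite [leRHS]big_mkcond; apply: ler_sum => i _.
case/andP: (p01 i) => p0 p1; case: ltnP => ik.
  by rewrite ler_piMr // subr_ge0; apply: l_anti.
by rewrite mulr_le0_ge0 // subr_le0; apply: l_anti; apply: ltnW.
Qed.

(** * Ky Fan's principle for projections *)

Section KyFan.
Variables (C : numClosedFieldType) (d : nat).
Implicit Types (U V W E : 'M[C]_d) (a b h : 'rV[C]_d).

Lemma isproj_form_ge0 E U j : isproj E -> 0 <= (U *m E *m U^t*) j j.
Proof.
move=> [hE EE]; rewrite -EE -{2}hE mulmxA -mulmxA -tcM mxE.
by apply: sumr_ge0 => i _; rewrite !mxE mul_conjC_ge0.
Qed.

Lemma unitary_diag1 U j : U \is unitarymx -> (U *m U^t*) j j = 1.
Proof. by move/unitarymxP->; rewrite mxE eqxx. Qed.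

Lemma isproj_form_le1 E U j : isproj E -> U \is unitarymx ->
  (U *m E *m U^t*) j j <= 1.
Proof.
move=> [hE EE] uU; have pE : isproj (1%:M - E).
  split; first by rewrite tcB tc1 hE.
  by rewrite mulmxBr !mulmxBl !mul1mx mulmx1 EE subrr subr0.
have := isproj_form_ge0 U j pE.
by rewrite mulmxBr mulmx1 mulmxBl mxE (unitary_diag1 j uU) mxE subr_ge0.
Qed.

Lemma mxtrace_spectral E U a :
  \tr (E *m (U^t* *m diag_mx a *m U)) = \sum_j a 0 j * (U *m E *m U^t*) j j.
Proof.
rewrite -!mulmxA mulmxA mulmxA mxtrace_mulC !mulmxA mxtrace_mulC.
by apply: eq_bigr => j _; rewrite mul_diag_mx mxE.
Qed.

(** The trace is a weighted sum of the [a 0 j] whose weights, the diagonal entries of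
    [U *m E *m U^t*], lie in [0, 1] and add up to the rank of [E]. *)
Lemma ky_fan_le E U a k : isproj E -> U \is unitarymx -> (\rank E <= k <= d)%N ->
  (forall i j : 'I_d, (i <= j)%N -> a 0 j <= a 0 i) -> (forall i, 0 <= a 0 i) ->
  \tr (E *m (U^t* *m diag_mx a *m U)) <= \sum_(j < d | (j < k)%N) a 0 j.
Proof.
move=> pE uU /andP[rE kd] a_anti a0; rewrite mxtrace_spectral.
apply: (weighted_sum_le kd a_anti a0) => [i|].
  by rewrite isproj_form_ge0 //= isproj_form_le1.
have -> : \sum_i (U *m E *m U^t*) i i = \tr (U *m E *m U^t*) by [].
rewrite mxtrace_mulC mulmxA -invmx_unitary // mulVmx ?unitarymx_unit //.
by rewrite mul1mx mxtrace_idem ?ler_nat //; case: pE.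
Qed.

(** A row of [U] inside the row space of [E] gets weight exactly 1; all other weights contribute
    nonnegative terms. *)
Lemma ky_fan_ge E U a (S : {set 'I_d}) : isproj E -> U \is unitarymx ->
  (forall i, 0 <= a 0 i) -> (forall i, i \in S -> (row i U <= E)%MS) ->
  \sum_(j in S) a 0 j <= \tr (E *m (U^t* *m diag_mx a *m U)).
Proof.
move=> pE uU a0 sub; rewrite mxtrace_spectral big_mkcond; apply: ler_sum => j _.
case: ifP => [/sub/submxP[D eD]|_]; last by rewrite mulr_ge0 ?isproj_form_ge0.
have e : row j (U *m E) = row j U by rewrite row_mul eD -mulmxA (proj2 pE).
suff -> : (U *m E *m U^t*) j j = 1 by rewrite mulr1.
rewrite -(unitary_diag1 j uU) !mxE; apply: eq_bigr => i _; congr (_ * _).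
by move/rowP/(_ i): e; rewrite !mxE.
Qed.

(* Test A + B against the projection onto the chosen eigenvectors of A and B. *)
Lemma sum_eigenvalues_le U V W a b h (S T : {set 'I_d}) k :
  U \is unitarymx -> V \is unitarymx -> W \is unitarymx ->
  (forall i, 0 <= a 0 i) -> (forall i, 0 <= b 0 i) -> (forall i, 0 <= h 0 i) ->
  (forall i j : 'I_d, (i <= j)%N -> h 0 j <= h 0 i) ->
  U^t* *m diag_mx a *m U + V^t* *m diag_mx b *m V = W^t* *m diag_mx h *m W ->
  (#|S| + #|T| <= k <= d)%N ->
  \sum_(j in S) a 0 j + \sum_(j in T) b 0 j <= \sum_(j < d | (j < k)%N) h 0 j.
Proof.
move=> uU uV uW a0 b0 h0 h_anti e /andP[STk kd].
pose M := (\sum_(i in S) <<row i U>> + \sum_(i in T) <<row i V>>)%MS.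
have rk X (I : {set 'I_d}) : (\rank (\sum_(i in I) <<row i X>>)%MS <= #|I|)%N.
  apply: leq_trans (mxrank_sum_leqif _) _ => /=; rewrite -sum1_card.
  by apply: leq_sum => i _; rewrite genmxE rank_leq_row.
have pE := isproj_ortho M.
have geS := ky_fan_ge (S := S) pE uU a0; have geT := ky_fan_ge (S := T) pE uV b0.
apply: le_trans (lerD (geS _) (geT _)) _ => {geS geT}.
- move=> i iS; rewrite proj_orthoE -(genmxE (row i U)).
  by apply: submx_trans (addsmxSl _ _); apply: (sumsmx_sup i).
- move=> i iS; rewrite proj_orthoE -(genmxE (row i V)).
  by apply: submx_trans (addsmxSr _ _); apply: (sumsmx_sup i).
rewrite -mxtraceD -mulmxDr e; apply: ky_fan_le => //.
rewrite proj_orthoE kd andbT; apply: leq_trans (mxrank_adds_leqif _ _) _.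
by apply: leq_trans STk; apply: leq_add.
Qed.

End KyFan.

(** * Selecting eigenvalues by counting, and passage to real values *)

Lemma top_sum_le_union (F : realFieldType) d (a b c : 'I_d -> F) k :
  (k <= d)%N -> (forall i j : 'I_d, (i <= j)%N -> c j <= c i) ->
  (forall i, 0 <= c i) ->
  (forall x : F, 0 < x -> (#|[set i | (x < c i)%R]| <=
                       #|[set i | (x < a i)%R]| + #|[set i | (x < b i)%R]|)%N) ->
  exists S T : {set 'I_d}, (#|S| + #|T| <= k)%N /\
    \sum_(i < d | (i < k)%N) c i <= \sum_(i in S) a i + \sum_(i in T) b i.
Proof.
move=> kd c_anti c0 cnt; elim: k kd => [|k IHk] kd.
  by exists set0, set0; rewrite !cards0 big_pred0 // !big_set0 addr0.
have [S [T [STk le_ST]]] := IHk (ltnW kd).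
pose m := Ordinal kd.
have sumS : \sum_(i < d | (i < k.+1)%N) c i = c m + \sum_(i < d | (i < k)%N) c i.
  rewrite (bigD1 m) //=; congr (_ + _); apply: eq_bigl => i.
  by rewrite -val_eqE /=; lia.
rewrite {}sumS.
case: (pickP (fun i => (i \notin S) && (c m <= a i))) => [i /andP[iS ai]|noS].
  exists (i |: S), T; rewrite cardsU1 iS big_setU1 //= -addrA.
  split; first by rewrite -addnA ltnS.
  exact: lerD.
case: (pickP (fun i => (i \notin T) && (c m <= b i))) => [i /andP[iT bi]|noT].
  exists S, (i |: T); rewrite cardsU1 iT big_setU1 //= addrCA.
  split; first by rewrite addnCA ltnS.
  exact: lerD.
have [cm0|cm_pos] := leP (c m) 0.
  exists S, T; split; first exact: leqW.
  by apply: le_trans le_ST; rewrite gerDr.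
pose x := Num.max (\big[Num.max/c m / 2]_(i | i \notin S) a i)
                  (\big[Num.max/c m / 2]_(i | i \notin T) b i).
have half : c m / 2 < c m by lra.
have x0 : 0 < x.
  rewrite lt_max; apply/orP; left.
  by apply: (@lt_le_trans _ _ (c m / 2)); [lra | exact: bigmax_ge_id].
have xc : x < c m.
  rewrite gt_max; apply/andP; split; apply/bigmax_ltP; split=> // i iN.
    by have := noS i; rewrite iN /= ltNge => ->.
  by have := noT i; rewrite iN /= ltNge => ->.
have subS : [set i | x < a i] \subset S.
  apply/subsetP => i; rewrite inE; apply: contraLR => iS.
  by rewrite -leNgt le_max (le_bigmax_cond _ a) ?iS.
have subT : [set i | x < b i] \subset T.
  apply/subsetP => i; rewrite inE; apply: contraLR => iT.
  by rewrite -leNgt le_max (le_bigmax_cond _ b) ?iT ?orbT.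
(* Indices [0] to [k] all have [c] above [x], whereas entries of [a] and [b] above [x] occur only in
   [S] and [T], at most [k] in total. *)
have kc : (k.+1 <= #|[set i | (x < c i)%R]|)%N.
  have <- : #|[set widen_ord kd j | j : 'I_k.+1]| = k.+1.
    rewrite card_imset ?card_ord // => u v /(congr1 val) /=.
    exact: val_inj.
  apply/subset_leq_card/subsetP => _ /imsetP[j _ ->]; rewrite inE.
  by apply: lt_le_trans xc _; apply: c_anti => /=; rewrite -ltnS.
have := leq_trans kc (leq_trans (cnt _ x0)
  (leq_add (subset_leq_card subS) (subset_leq_card subT))).
by move/leq_trans/(_ STk); rewrite ltnn.
Qed.

Lemma rank_proj_join (C : numClosedFieldType) d (P Q : 'M[C]_d) :
  (\rank (proj_join P Q) <= \rank P + \rank Q)%N.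
Proof. by rewrite proj_orthoE mxrank_adds_leqif. Qed.

(** Links complex diagonalizations to real eigenvalues: [iota] reflects the order, so the inequality
    descends to [F]. *)
Lemma sum_eigenvalues_le_map (F : numDomainType) (C : numClosedFieldType) d
    (iota : {rmorphism F -> C}) (U V W : 'M[C]_d) (a b h : 'rV[F]_d)
    (S T : {set 'I_d}) k :
  {mono iota : x y / x <= y} ->
  U \is unitarymx -> V \is unitarymx -> W \is unitarymx ->
  (forall i, 0 <= a 0 i) -> (forall i, 0 <= b 0 i) -> (forall i, 0 <= h 0 i) ->
  (forall i j : 'I_d, (i <= j)%N -> h 0 j <= h 0 i) ->
  U^t* *m diag_mx (map_mx iota a) *m U + V^t* *m diag_mx (map_mx iota b) *m V =
    W^t* *m diag_mx (map_mx iota h) *m W ->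
  (#|S| + #|T| <= k <= d)%N ->
  \sum_(j in S) a 0 j + \sum_(j in T) b 0 j <= \sum_(j < d | (j < k)%N) h 0 j.
Proof.
move=> le_iota uU uV uW a0 b0 h0 h_anti e STk.
have ge0 (y : 'rV[F]_d) : (forall i, 0 <= y 0 i) -> forall i, 0 <= map_mx iota y 0 i.
  by move=> y0 i; rewrite mxE -(rmorph0 iota) le_iota.
rewrite -le_iota rmorphD !rmorph_sum.
have := sum_eigenvalues_le uU uV uW (ge0 a a0) (ge0 b b0) (ge0 h h0) _ e STk.
have sumE (y : 'rV[F]_d) (P : pred 'I_d) :
    \sum_(i | P i) map_mx iota y 0 i = \sum_(i | P i) iota (y 0 i).
  by apply: eq_bigr => i _; rewrite mxE.
rewrite !sumE.
by apply=> i j ij; rewrite !mxE le_iota h_anti.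
Qed.

(** * Permuted diagonalizations and unitary averages of diagonal matrices *)

Section Reindex.
Variables (C : numClosedFieldType) (d : nat).
Implicit Types (U : 'M[C]_d) (a : 'rV[C]_d) (s : 'S_d).

Lemma row_perm_unitary s U : U \is unitarymx -> row_perm s U \is unitarymx.
Proof.
move/unitarymxP => uU; apply/unitarymxP/matrixP => i j.
have /matrixP/(_ (s i) (s j)) := uU.
rewrite !mxE (inj_eq perm_inj) => <-; apply: eq_bigr => l _.
by rewrite !mxE.
Qed.

Lemma diag_row_perm s U a :
  (row_perm s U)^t* *m diag_mx (col_perm s a) *m row_perm s U =
  U^t* *m diag_mx a *m U.
Proof.
apply/matrixP => i j; rewrite !mul_mx_diag !mxE [RHS](reindex_inj (@perm_inj _ s)).
by apply: eq_bigr => l _; rewrite !mxE.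
Qed.

Lemma diag_unitary a : (forall i, a 0 i * (a 0 i)^* = 1) -> diag_mx a \is unitarymx.
Proof.
move=> a1; apply/unitarymxP/matrixP => i j; rewrite mul_diag_mx !mxE eq_sym.
by case: eqVneq => [->|_]; rewrite ?mulr1n ?a1 // rmorph0 mulr0.
Qed.

(* A number t in [0, 1] is the average of the conjugate unimodular numbers
   t +- i sqrt(1 - t^2). *)
Lemma diag_contraction a (r : C) : (forall i, 0 <= a 0 i <= 1) -> r + r = 1 ->
  exists2 U : 'M[C]_d, U \is unitarymx & diag_mx a = r *: U + r *: U^t*.
Proof.
move=> a01 r1; pose c := \row_i (a 0 i + 'i * sqrtC (1 - a 0 i ^+ 2)).
have s0 i : 0 <= 1 - a 0 i ^+ 2.
  by case/andP: (a01 i) => a0 a1; rewrite subr_ge0 expr_le1.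
have aR i : a 0 i \is Num.real by case/andP: (a01 i) => /ger0_real.
have sR i : sqrtC (1 - a 0 i ^+ 2) \is Num.real by rewrite ger0_real ?sqrtC_ge0.
exists (diag_mx c).
  apply: diag_unitary => i; rewrite -normCK mxE normC2_rect // sqrtCK.
  by rewrite addrC subrK.
apply/matrixP => i j; rewrite !mxE [j == i]eq_sym.
case: eqVneq => [->|_]; last by rewrite rmorph0 !mulr0 addr0.
rewrite !mulr1n conjC_rect // -mulrDr addrACA subrr addr0.
by rewrite mulrDr -mulrDl r1 mul1r.
Qed.

End Reindex.

(** * Ordered eigenvalues and the submajorization *)

Section Eigenvalues.
Variables (R : realType) (d : nat).
Implicit Types (X A B : 'M[R[i]]_d).

Definition eigrow X : 'rV[R]_d := \row_j (eigvals_down X)`_j.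

(** Both families list the roots of [char_poly X] with multiplicity, as [X] is similar to its
    diagonal form. *)
Lemma spectral_diag_perm X : X \is hermsymmx ->
  exists s : 'S_d, forall i, spectral_diag X 0 (s i) = (eigrow X 0 i)%:C.
Proof.
move=> hX.
pose t := [tuple spectral_diag X 0 i | i < d].
have /tuple_permP[s sE] : perm_eq [seq a%:C | a <- eigvals_down X] t.
  apply: prod_XsubC_eq; rewrite big_map -(char_poly_eigvals_down hX).
  have /spectral_mul XE := hermitian_normalmx hX.
  rewrite (char_poly_similar (spectral_unit X) XE).
  rewrite char_poly_trig ?diag_mx_is_trig // big_map big_enum /=.
  by apply: eq_bigr => i _; rewrite mxE eqxx.
exists s => i; rewrite mxE.
have := congr1 (fun r => nth 0 r i) sE.
rewrite (nth_map 0) ?size_eigvals_down // => ->.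
by rewrite -tnth_nth !tnth_mktuple.
Qed.

Lemma spectral_down X : X \is hermsymmx -> exists2 U : 'M[R[i]]_d,
  U \is unitarymx & X = U^t* *m diag_mx (map_mx (real_complex R) (eigrow X)) *m U.
Proof.
move=> hX; have [s sE] := spectral_diag_perm hX.
exists (row_perm s (spectralmx X)).
  exact/row_perm_unitary/spectral_unitarymx.
have -> : map_mx (real_complex R) (eigrow X) = col_perm s (spectral_diag X).
  by apply/rowP => i; rewrite [RHS]mxE sE mxE.
rewrite diag_row_perm -invmx_unitary ?spectral_unitarymx //.
exact/orthomx_spectralP/hermitian_normalmx.
Qed.

(** The rank of an idempotent is its trace, which here is a sum of 0/1 indicators over the
    eigenvalues. *)
Lemma rank_spec_proj x X : X \is hermsymmx ->
  \rank (spec_proj x%:C X) = #|[set i | x < eigrow X 0 i]|.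
Proof.
move=> hX; have [s sE] := spectral_diag_perm hX.
apply/eqP; rewrite -(eqr_nat R[i]) -mxtrace_idem; last first.
  by case: (isproj_spec x%:C X).
rewrite /spec_proj /funcalc mxtrace_mulC mulKVmx ?spectral_unit //.
rewrite mxtrace_diag (reindex_inj (@perm_inj _ s)) -sum1_card natr_sum.
apply/eqP; rewrite [RHS]big_mkcond.
apply: eq_bigr => i _; rewrite mxE sE ltcR inE.
by case: ltP.
Qed.

Lemma eigrow_anti X (i j : 'I_d) : X \is hermsymmx -> (i <= j)%N ->
  eigrow X 0 j <= eigrow X 0 i.
Proof.
move=> hX ij; rewrite !mxE.
apply: (sorted_leq_nth _ _ 0 (eigvals_down_sorted X)) => [a b c ba cb|a|||] //=.
- exact: le_trans cb ba.
- by rewrite inE size_eigvals_down.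
- by rewrite inE size_eigvals_down.
Qed.

Lemma eigrow_ge0 X i : psdmx X -> 0 <= eigrow X 0 i.
Proof.
move=> pX; have [s sE] := spectral_diag_perm (proj1 pX).
by have := spectral_diag_ge0 (s i) pX; rewrite sE lecR.
Qed.

Lemma top_sum_spec_sup A B k : psdmx A -> psdmx B -> (k <= d)%N ->
  \sum_(i < d | (i < k)%N) eigrow (spec_sup A B) 0 i <=
  \sum_(i < d | (i < k)%N) eigrow (A + B) 0 i.
Proof.
move=> pA pB kd; have pAB := psdmxD pA pB.
have [pC _ _ _] := spec_supP pA pB.
have projC x := @spec_proj_sup _ _ A B x pA pB.
move: (spec_sup A B) pC projC => D pD projD.
have [[hA _] [hB _] [hD _]] := And3 pA pB pD.
have cnt (x : R) : 0 < x -> (#|[set i | (x < eigrow D 0 i)%R]| <=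
    #|[set i | (x < eigrow A 0 i)%R]| + #|[set i | (x < eigrow B 0 i)%R]|)%N.
  move=> x0; have := rank_proj_join (spec_proj x%:C A) (spec_proj x%:C B).
  rewrite -projD //.
  by rewrite (rank_spec_proj x hD) [X in (_ <= X + _)%N](rank_spec_proj x hA)
             [X in (_ <= _ + X)%N](rank_spec_proj x hB).
have [S [T [STk]]] := top_sum_le_union kd
  (fun i j => @eigrow_anti _ i j (proj1 pD)) (fun i => eigrow_ge0 i pD) cnt.
move/le_trans; apply.
have [U uU eA] := spectral_down (proj1 pA).
have [V uV eB] := spectral_down (proj1 pB).
have [W uW eAB] := spectral_down (proj1 pAB).
rewrite {1}eA {1}eB in eAB.
apply: (sum_eigenvalues_le_map (@lecR R) uU uV uW _ _ _ _ eAB).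
- by move=> i; exact: eigrow_ge0.
- by move=> i; exact: eigrow_ge0.
- by move=> i; exact: eigrow_ge0.
- exact: (fun i j => @eigrow_anti _ i j (proj1 pAB)).
- by rewrite STk kd.
Qed.

End Eigenvalues.

(** * Symmetric norms as gauge functions of eigenvalues *)

Section SymmetricGauge.
Variables (R : realType) (d : nat) (N : 'M[R[i]]_d -> R).
Hypothesis hN : symmetric_norm N.
Implicit Types (y : 'rV[R]_d) (t : R).

(** Von Neumann's symmetric gauge function attached to [N]. *)
Definition gauge y : R := N (diag_mx (map_mx (real_complex R) y)).

Lemma symmetric_norm_scale t X : 0 <= t -> N (t%:C *: X) = t * N X.
Proof.
move=> t0; have := symmetric_normZ hN t%:C X.
by rewrite ger0_norm ?lecR // -rmorphM => /complexI.
Qed.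

Lemma gauge_convex t y z : 0 <= t <= 1 ->
  gauge ((1 - t) *: y + t *: z) <= (1 - t) * gauge y + t * gauge z.
Proof.
move=> /andP[t0 t1]; rewrite /gauge map_mxD !map_mxZ !linearD !linearZ /=.
apply: le_trans (symmetric_normD hN _ _) _.
by rewrite !symmetric_norm_scale // subr_ge0.
Qed.

Lemma gauge_xcol i j y : gauge (xcol i j y) = gauge y.
Proof.
have u1 : (1%:M : 'M[R[i]]_d) \is unitarymx by apply/unitarymxP; rewrite tc1 mulmx1.
pose W := row_perm (tperm i j) (1%:M : 'M[R[i]]_d).
have uW : W \is unitarymx by exact: row_perm_unitary.
rewrite /gauge map_col_perm.
rewrite -(symmetric_normU hN (U := W^t*) (V := W)) ?trmxC_unitary //.
by rewrite diag_row_perm tc1 mul1mx mulmx1.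
Qed.

(** Write [x] as [y] scaled coordinatewise by factors in [0, 1]. The diagonal matrix of factors is
    the average of a unitary and its adjoint, and neither changes the norm. *)
Lemma gauge_mono (x y : 'rV[R]_d) :
  (forall i, 0 <= x 0 i <= y 0 i) -> gauge x <= gauge y.
Proof.
(* Where [y 0 i = 0] the quotient is 0 by convention, which is consistent since [x 0 i = 0] there
   too. *)
move=> xy; pose t := map_mx (real_complex R) (\row_i (x 0 i / y 0 i)).
have t01 i : 0 <= t 0 i <= 1.
  have /andP[x0 xyi] := xy i; have y0 := le_trans x0 xyi.
  rewrite !mxE -(rmorph0 (real_complex R)) -(rmorph1 (real_complex R)) !lecR.
  rewrite divr_ge0 //=; have [->|y_neq0] := eqVneq (y 0 i) 0.
    by rewrite invr0 mulr0 ler01.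
  by rewrite ler_pdivrMr ?mul1r // lt_neqAle eq_sym y_neq0.
have tyE : diag_mx (map_mx (real_complex R) x) =
    diag_mx t *m diag_mx (map_mx (real_complex R) y).
  rewrite mulmx_diag; congr diag_mx; apply/rowP => i; rewrite !mxE -rmorphM.
  have [y0|y_neq0] := eqVneq (y 0 i) 0; last by rewrite divfK.
  by rewrite y0 mulr0; congr (_%:C); apply/le_anti; have := xy i; rewrite y0 andbC.
have halfE : (2^-1)%:C + (2^-1)%:C = 1 :> R[i].
  by rewrite -rmorphD -[RHS]/(1%:C); congr (_%:C); lra.
have [U uU tE] := diag_contraction t01 halfE.
have u1 : (1%:M : 'M[R[i]]_d) \is unitarymx by apply/unitarymxP; rewrite tc1 mulmx1.
have NU V : V \is unitarymx ->
    N (V *m diag_mx (map_mx (real_complex R) y)) = gauge y.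
  move=> uV; have := symmetric_normU hN (diag_mx (map_mx (real_complex R) y)) uV u1.
  by rewrite mulmx1.
rewrite {1}/gauge tyE tE mulmxDl -!scalemxAl.
apply: le_trans (symmetric_normD hN _ _) _.
rewrite !symmetric_norm_scale ?invr_ge0 ?ler0n // !NU ?trmxC_unitary //.
by rewrite -mulrDl; lra.
Qed.

Lemma symmetric_norm_gauge X : X \is hermsymmx -> N X = gauge (eigrow X).
Proof.
move=> hX; have [U uU XE] := spectral_down hX.
by rewrite {1}XE (symmetric_normU hN) ?trmxC_unitary.
Qed.

End SymmetricGauge.

Theorem corollary3p8 (R : realType) (d : nat) (hd : (1 <= d)%N)
  (A B : 'M[R[i]]_d) (hA : psdmx A) (hB : psdmx B) :
  (forall N : 'M[R[i]]_d -> R, symmetric_norm N ->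
     N (spec_sup A B) <= N (A + B)) /\
  submaj (spec_sup A B) (A + B).
Proof.
have top k := @top_sum_spec_sup R d A B k hA hB.
have hAB := psdmxD hA hB; have [hC _ _ _] := spec_supP hA hB.
move: (spec_sup A B) (A + B) top hAB hC => X Y top hY hX.
split=> [N hN|k /andP[_ kd]].
  (* Fan dominance: both norms become gauges of nonnegative decreasing eigenvalue vectors, whose
     partial sums are compared by [top]. *)
  rewrite (symmetric_norm_gauge hN (proj1 hX)) (symmetric_norm_gauge hN (proj1 hY)).
  apply: (submajorized_gauge_le (gauge_convex hN) (gauge_xcol hN) (gauge_mono hN)).
  - by move=> i j; apply: eigrow_anti; case: hX.
  - by move=> i; apply: eigrow_ge0.
  - by move=> i; apply: eigrow_ge0.
  - exact: top.
have sumE (Z : 'M[R[i]]_d) : \sum_(i < d | (i < k)%N) eigrow Z 0 i =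
    \sum_(i < k) (eigvals_down Z)`_i.
  rewrite (big_ord_widen d (fun j => (eigvals_down Z)`_j) kd).
  by apply: eq_bigr => i _; rewrite mxE.
by rewrite -(sumE X); apply: le_trans (top k kd) _; rewrite (sumE Y).
Qed.
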